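(* The Lie group $F_{4,\mathbb{R}}$ is isomorphic to the Lie group $SO(3)$: $F_{4,\mathbb{R}}\cong SO(3)$.
   Context: Let $\mathfrak{J}_{\mathbb{R}}$ be the 6-dimensional real vector space of symmetric $3\times 3$ real matrices, with the Jordan multiplication $X\circ Y=\frac12(XY+YX)$. Define $F_{4,\mathbb{R}}=\{\alpha\in \mathrm{Iso}_{\mathbb{R}}(\mathfrak{J}_{\mathbb{R}}) \mid \alpha(X\circ Y)=\alpha X\circ\alpha Y \text{ for all } X,Y\}$, where $\mathrm{Iso}_{\mathbb{R}}(V)$ denotes the group of $\mathbb{R}$-linear automorphisms of $V$. *)

(* Defs.v *)
From HB Require Import structures.
From mathcomp Require Import all_boot all_order all_fingroup all_algebra.
From mathcomp Require Import all_classical all_reals all_analysis.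

Set Implicit Arguments.
Unset Strict Implicit.
Unset Printing Implicit Defensive.
Import Order.TTheory GRing.Theory Num.Theory.
Import numFieldNormedType.Exports VectorInternalTheory.
Local Open Scope classical_set_scope.
Local Open Scope ring_scope.

(* C^k and C^oo maps on an open subset U of R^m. In finite dimension, asking
   all iterated directional derivatives to exist and be continuous on U is the
   usual notion. *)
Fixpoint class_C (R : realType) (m n k : nat) (U : set 'rV[R]_m)
    (f : 'rV[R]_m -> 'rV[R]_n) : Prop :=
  (forall x, U x -> {for x, continuous f}) /\
  match k with
  | 0%N => True
  | k'.+1 => forall v : 'rV[R]_m,
      (forall x, U x -> derivable f x v) /\
      class_C k' U (fun x => 'D_v f x)
  end.

Definition class_Coo (R : realType) (m n : nat) (U : set 'rV[R]_m)
    (f : 'rV[R]_m -> 'rV[R]_n) : Prop :=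
  forall k, class_C k U f.

(* A Lie group presented as a closed subgroup of GL(V), for V a
   finite-dimensional real vector space: by Cartan's theorem the image of
   lie_rep is an embedded submanifold of End(V), and this is the manifold
   structure carried by the group. v2r identifies End(V) with R^N; its topology
   and smooth structure do not depend on the underlying choice of a basis. *)
Record linearLieGroup (R : realType) := LinearLieGroup {
  lie_sort :> groupType;
  lie_space : vectType R;
  lie_rep : lie_sort -> 'End(lie_space);
  lie_rep_inj : injective lie_rep;
  lie_rep1 : lie_rep 1%g = \1%VF;
  lie_repM : forall g h, lie_rep (g * h)%g = (lie_rep g \o lie_rep h)%VF;
  lie_rep_closed : exists2 C : set 'rV[R]_(dim 'End(lie_space)), closed C &
    forall a : 'End(lie_space),
      (exists g, lie_rep g = a) <-> (bijective a /\ C (v2r a))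
}.

Definition lie_coord (R : realType) (G : linearLieGroup R) (g : G) :
    'rV[R]_(dim 'End(lie_space G)) :=
  v2r (lie_rep g).

(* Smoothness of a map between embedded submanifolds of R^m and R^n: near every
   point it is the restriction of a C^oo map defined on an open set of R^m. *)
Definition lie_smooth (R : realType) (G H : linearLieGroup R) (f : G -> H) :
    Prop :=
  forall g : G, exists U F,
    [/\ open U, U (lie_coord g), class_Coo U F &
        forall h : G, U (lie_coord h) -> F (lie_coord h) = lie_coord (f h)].

Definition lie_isomorphic (R : realType) (G H : linearLieGroup R) : Prop :=
  exists (f : {multiplicative G -> H}) (g : H -> G),
    [/\ cancel f g, cancel g f, lie_smooth f & lie_smooth g].

Section ContinuityFacts.
Variable R : realType.

Lemma closed_eq_continuous (T : topologicalType) (f g : T -> R) :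
  continuous f -> continuous g -> closed [set x | f x = g x].
Proof.
move=> cf cg.
have -> : [set x | f x = g x] = (fun x => f x - g x) @^-1` [set x | x = 0].
  apply/seteqP; split => x /=; first by move=> ->; rewrite subrr.
  by move/eqP; rewrite subr_eq0 => /eqP.
apply: preimage_closed; last exact: closed_eq.
by move=> x _; apply: cvgB; [apply: cf | apply: cg].
Qed.

Lemma continuous_add_fct (T : topologicalType) (f g : T -> R) :
  continuous f -> continuous g -> continuous (fun x => f x + g x).
Proof. by move=> cf cg x; apply: cvgD; [apply: cf | apply: cg]. Qed.

Lemma continuous_mul_fct (T : topologicalType) (f g : T -> R) :
  continuous f -> continuous g -> continuous (fun x => f x * g x).
Proof. by move=> cf cg x; apply: cvgM; [apply: cf | apply: cg]. Qed.

Lemma continuous_cst_fct (T : topologicalType) (c : R) :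
  continuous (fun _ : T => c).
Proof. by move=> x; apply: cvg_cst. Qed.

Lemma continuous_sum_fct (T : topologicalType) (I : Type) (r : seq I)
    (P : pred I) (F : I -> T -> R) :
  (forall i, continuous (F i)) ->
  continuous (fun x => \sum_(i <- r | P i) F i x).
Proof. by move=> cF; apply: continuous_big => //; apply: add_continuous. Qed.

Lemma continuous_prod_fct (T : topologicalType) (I : Type) (r : seq I)
    (P : pred I) (F : I -> T -> R) :
  (forall i, continuous (F i)) ->
  continuous (fun x => \prod_(i <- r | P i) F i x).
Proof. by move=> cF; apply: continuous_big => //; apply: mul_continuous. Qed.

Lemma linear_rV_continuous m (f : 'rV[R]_m -> R) :
  scalar f -> continuous f.
Proof.
move=> lf.
pose f' : {linear 'rV[R]_m -> R^o} :=
  HB.pack f (GRing.isLinear.Build R 'rV[R]_m R^o *%R f lf).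
have -> : f = fun x => \sum_j x ord0 j * f (delta_mx 0 j).
  apply/funext => x; rewrite {1}(row_sum_delta x) (_ : f = f') //.
  by rewrite linear_sum; apply: eq_bigr => j _; rewrite linearZ.
apply: continuous_sum_fct => j; apply: continuous_mul_fct; last exact: continuous_cst_fct.
exact: coord_continuous.
Qed.

End ContinuityFacts.

Definition SO3_pred (R : realType) : pred 'M[R]_3 :=
  fun A => (A *m A^T == 1%:M) && (\det A == 1).

Definition SO3 (R : realType) := {A : 'M[R]_3 | SO3_pred A}.

HB.instance Definition _ (R : realType) := Choice.on (SO3 R).

Section SO3Group.
Variable R : realType.
Implicit Types A B : SO3 R.

Lemma SO3_id_subproof : SO3_pred (1%:M : 'M[R]_3).
Proof. by rewrite /SO3_pred trmx1 mulmx1 det1 !eqxx. Qed.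

Lemma SO3_inv_subproof A : SO3_pred (val A)^T.
Proof.
case: A => A /= /andP[/eqP AA /eqP dA].
by rewrite /SO3_pred det_tr dA trmxK (mulmx1C AA) !eqxx.
Qed.

Lemma SO3_mul_subproof A B : SO3_pred (val A *m val B).
Proof.
case: A B => A /= /andP[/eqP AA /eqP dA] [B /= /andP[/eqP BB /eqP dB]].
rewrite /SO3_pred det_mulmx dA dB mulr1 trmx_mul mulmxA -(mulmxA A).
by rewrite BB mulmx1 AA !eqxx.
Qed.

Definition SO3_id : SO3 R := exist [eta @SO3_pred R] _ SO3_id_subproof.
Definition SO3_inv A : SO3 R := exist [eta @SO3_pred R] _ (SO3_inv_subproof A).
Definition SO3_mul A B : SO3 R := exist [eta @SO3_pred R] _ (SO3_mul_subproof A B).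

Lemma SO3_mulA : associative SO3_mul.
Proof. by move=> A B C; apply: val_inj; rewrite /= mulmxA. Qed.
Lemma SO3_mul1 : left_id SO3_id SO3_mul.
Proof. by move=> A; apply: val_inj; rewrite /= mul1mx. Qed.
Lemma SO3_mulr1 : right_id SO3_id SO3_mul.
Proof. by move=> A; apply: val_inj; rewrite /= mulmx1. Qed.
Lemma SO3_mulV : left_inverse SO3_id SO3_inv SO3_mul.
Proof.
move=> A; apply: val_inj => /=.
by case: A => A /= /andP[/eqP AA _]; apply: mulmx1C.
Qed.
Lemma SO3_mulrV : right_inverse SO3_id SO3_inv SO3_mul.
Proof.
by move=> A; apply: val_inj; case: A => A /= /andP[/eqP AA _].
Qed.

End SO3Group.

HB.instance Definition _ (R : realType) := isGroup.Build (SO3 R)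
  (@SO3_mulA R) (@SO3_mul1 R) (@SO3_mulr1 R) (@SO3_mulV R) (@SO3_mulrV R).

Definition SO3_rep (R : realType) (A : SO3 R) : 'End('cV[R]_3) :=
  linfun (mulmx (val A)).

Section SO3Lie.
Variable R : realType.

Lemma SO3_repE (A : SO3 R) (x : 'cV[R]_3) : SO3_rep A x = val A *m x.
Proof. by rewrite lfunE. Qed.

Lemma SO3_rep_inj : injective (@SO3_rep R).
Proof.
move=> A B AB; apply: val_inj; apply/matrixP => i j.
have := congr1 (fun f : 'End('cV[R]_3) => f (delta_mx j 0) i 0) AB.
by rewrite !SO3_repE -!colE !mxE.
Qed.

Lemma SO3_rep1 : SO3_rep (1%g : SO3 R) = \1%VF.
Proof. by apply/lfunP => x; rewrite SO3_repE id_lfunE mul1mx. Qed.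

Lemma SO3_repM (A B : SO3 R) :
  SO3_rep (A * B)%g = (SO3_rep A \o SO3_rep B)%VF.
Proof. by apply/lfunP => x; rewrite comp_lfunE !SO3_repE mulmxA. Qed.

Lemma SO3_rep_closed :
  exists2 C : set 'rV[R]_(dim 'End('cV[R]_3)), closed C &
    forall a : 'End('cV[R]_3),
      (exists A : SO3 R, SO3_rep A = a) <-> (bijective a /\ C (v2r a)).
Proof.
pose mx (a : 'End('cV[R]_3)) : 'M[R]_3 :=
  \matrix_(i, j) a (delta_mx j 0) i 0.
have mxE' (a : 'End('cV[R]_3)) x : a x = mx a *m x.
  rewrite {1}(matrix_sum_delta x) linear_sum; apply/matrixP => i k.
  rewrite summxE mxE; apply: eq_bigr => j _.
  rewrite big_ord1 linearZ [in LHS]mxE !ord1 [mx a i j]mxE mulrC.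
  by congr (_ * x _ _); apply/ord_inj.
pose e i j (x : 'rV[R]_(dim 'End('cV[R]_3))) := mx (r2v x) i j.
have ce i j : continuous (e i j).
  apply: linear_rV_continuous => c x y.
  by rewrite /e !mxE linearD linearZ /= add_lfunE scale_lfunE !mxE.
exists ((\bigcap_(ij in [set: 'I_3 * 'I_3])
          [set x | \sum_k e ij.1 k x * e ij.2 k x = (ij.1 == ij.2)%:R]) `&`
        [set x | \sum_(s : 'S_3) (-1) ^+ s * \prod_i e i (s i) x = 1]).
  apply: closedI; first apply: closed_bigI => ij _.
    apply: closed_eq_continuous; last exact: continuous_cst_fct.
    by apply: continuous_sum_fct => k; apply: continuous_mul_fct; apply: ce.
  apply: closed_eq_continuous; last exact: continuous_cst_fct.
  apply: continuous_sum_fct => s; apply: continuous_mul_fct.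
    exact: continuous_cst_fct.
  by apply: continuous_prod_fct => i; apply: ce.
move=> a; split=> [[A <-]|[_ [aO aD]]].
  have mA : mx (SO3_rep A) = val A.
    by apply/matrixP => i j; rewrite !mxE SO3_repE -colE mxE.
  split.
    exists (SO3_rep (A^-1)%g) => x; rewrite !SO3_repE mulmxA.
      by have := congr1 val (mulVg A) => /= ->; rewrite mul1mx.
    by have := congr1 val (mulgV A) => /= ->; rewrite mul1mx.
  have /andP[/eqP AA /eqP dA] := valP A.
  split; rewrite /= /e.
    move=> [i j] _ /=; rewrite v2rK mA.
    have := congr1 (fun M : 'M[R]_3 => M i j) AA.
    by rewrite !mxE => <-; apply: eq_bigr => k _; rewrite mxE.
  by rewrite v2rK mA.
move: aD; rewrite /= /e v2rK => aD.
have aSO : SO3_pred (mx a).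
  apply/andP; split; last exact/eqP.
  apply/eqP/matrixP => i j; have aOij := aO (i, j) I; rewrite /= /e v2rK in aOij.
  rewrite [LHS]mxE [in RHS]mxE -aOij; apply: eq_bigr => k _.
  by rewrite [_^T _ _]mxE.
exists (exist [eta @SO3_pred R] (mx a) aSO); apply/lfunP => x.
by rewrite SO3_repE /= -mxE'.
Qed.

End SO3Lie.

Definition SO3_lie (R : realType) : linearLieGroup R :=
  LinearLieGroup (@SO3_rep_inj R) (SO3_rep1 R) (@SO3_repM R)
    (SO3_rep_closed R).

Definition symmx3 (R : realType) : {vspace 'M[R]_3} :=
  fixedSpace (linfun (@trmx R 3 3)).

Lemma mem_symmx3 (R : realType) (X : 'M[R]_3) :
  (X \in symmx3 R) = (X^T == X).
Proof. by apply/fixedSpaceP/eqP; rewrite lfunE. Qed.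

Definition jordan3 (R : realType) : vectType R := subvs_of (symmx3 R).

Lemma jordan_mul_subproof (R : realType) (X Y : jordan3 R) :
  2^-1 *: (vsval X *m vsval Y + vsval Y *m vsval X) \in symmx3 R.
Proof.
rewrite mem_symmx3 linearZ linearD /= !trmx_mul.
have /eqP -> : (vsval X)^T == vsval X by rewrite -mem_symmx3 subvsP.
have /eqP -> : (vsval Y)^T == vsval Y by rewrite -mem_symmx3 subvsP.
by rewrite addrC.
Qed.

Definition jordan_mul (R : realType) (X Y : jordan3 R) : jordan3 R :=
  Subvs (jordan_mul_subproof X Y).

Definition F4R_pred (R : realType) : pred 'End(jordan3 R) :=
  fun a => `[< bijective a /\
    forall X Y, a (jordan_mul X Y) = jordan_mul (a X) (a Y) >].

Definition F4R (R : realType) := {a : 'End(jordan3 R) | F4R_pred a}.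

HB.instance Definition _ (R : realType) := Choice.on (F4R R).

Section F4RGroup.
Variable R : realType.
Implicit Types a b : F4R R.

Lemma F4R_lker0 a : lker (val a) == 0%VS.
Proof.
by apply/lker0P; case: a => a /= /asboolP[/bij_inj].
Qed.

Lemma F4R_invK a x : (val a)^-1%VF (val a x) = x.
Proof. exact: lker0_lfunK (F4R_lker0 a) x. Qed.

Lemma F4R_Kinv a x : val a ((val a)^-1%VF x) = x.
Proof. exact: lker0_lfunVK (F4R_lker0 a) x. Qed.

Lemma F4R_id_subproof : F4R_pred (\1%VF : 'End(jordan3 R)).
Proof.
apply/asboolP; split; last by move=> X Y; rewrite !id_lfunE.
by exists id => x; rewrite id_lfunE.
Qed.

Lemma F4R_inv_subproof a : F4R_pred (val a)^-1%VF.
Proof.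
apply/asboolP; split.
  by exists (val a) => x; [apply: F4R_Kinv | apply: F4R_invK].
move=> X Y; rewrite -{1}(F4R_Kinv a X) -{1}(F4R_Kinv a Y).
by have /asboolP[_ <-] := valP a; rewrite F4R_invK.
Qed.

Lemma F4R_mul_subproof a b : F4R_pred (val a \o val b)%VF.
Proof.
have /asboolP[ba ma] := valP a; have /asboolP[bb mb] := valP b.
apply/asboolP; split; last by move=> X Y; rewrite !comp_lfunE mb ma.
apply: (eq_bij (bij_comp ba bb)) => x; exact/esym/comp_lfunE.
Qed.

Definition F4R_id : F4R R := exist [eta @F4R_pred R] _ F4R_id_subproof.
Definition F4R_inv a : F4R R := exist [eta @F4R_pred R] _ (F4R_inv_subproof a).
Definition F4R_mul a b : F4R R := exist [eta @F4R_pred R] _ (F4R_mul_subproof a b).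

Lemma F4R_mulA : associative F4R_mul.
Proof. by move=> a b c; apply: val_inj; rewrite /= comp_lfunA. Qed.
Lemma F4R_mul1 : left_id F4R_id F4R_mul.
Proof. by move=> a; apply: val_inj; rewrite /= comp_lfun1l. Qed.
Lemma F4R_mulr1 : right_id F4R_id F4R_mul.
Proof. by move=> a; apply: val_inj; rewrite /= comp_lfun1r. Qed.
Lemma F4R_mulV : left_inverse F4R_id F4R_inv F4R_mul.
Proof.
move=> a; apply: val_inj; apply/lfunP => x.
by rewrite /= comp_lfunE id_lfunE F4R_invK.
Qed.
Lemma F4R_mulrV : right_inverse F4R_id F4R_inv F4R_mul.
Proof.
move=> a; apply: val_inj; apply/lfunP => x.
by rewrite /= comp_lfunE id_lfunE F4R_Kinv.
Qed.

End F4RGroup.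

HB.instance Definition _ (R : realType) := isGroup.Build (F4R R)
  (@F4R_mulA R) (@F4R_mul1 R) (@F4R_mulr1 R) (@F4R_mulV R) (@F4R_mulrV R).

Definition F4R_rep (R : realType) (a : F4R R) : 'End(jordan3 R) := val a.

Section F4RLie.
Variable R : realType.

Lemma F4R_rep_inj : injective (@F4R_rep R).
Proof. exact: val_inj. Qed.

Lemma F4R_rep1 : F4R_rep (1%g : F4R R) = \1%VF.
Proof. by []. Qed.

Lemma F4R_repM (a b : F4R R) : F4R_rep (a * b)%g = (F4R_rep a \o F4R_rep b)%VF.
Proof. by []. Qed.

Lemma F4R_rep_closed :
  exists2 C : set 'rV[R]_(dim 'End(jordan3 R)), closed C &
    forall a : 'End(jordan3 R),
      (exists g : F4R R, F4R_rep g = a) <-> (bijective a /\ C (v2r a)).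
Proof.
pose e (X : jordan3 R) i j (x : 'rV[R]_(dim 'End(jordan3 R))) : R :=
  vsval (r2v x X) i j.
have ce X i j : continuous (e X i j).
  apply: linear_rV_continuous => c x y.
  by rewrite /e linearD linearZ /= add_lfunE scale_lfunE linearD linearZ !mxE.
exists (\bigcap_(p in [set: (jordan3 R * jordan3 R) * ('I_3 * 'I_3)])
  [set x | e (jordan_mul p.1.1 p.1.2) p.2.1 p.2.2 x =
     2^-1 * (\sum_k e p.1.1 p.2.1 k x * e p.1.2 k p.2.2 x +
             \sum_k e p.1.2 p.2.1 k x * e p.1.1 k p.2.2 x)]).
  apply: closed_bigI => -[[X Y] [i j]] _ /=.
  apply: closed_eq_continuous; first exact: ce.
  apply: continuous_mul_fct; first exact: continuous_cst_fct.
  by apply: continuous_add_fct; apply: continuous_sum_fct => k;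
    apply: continuous_mul_fct; apply: ce.
move=> a; split=> [[g <-]|[ba aC]].
  have /asboolP[bg mg] := valP g; split=> //.
  move=> [[X Y] [i j]] _ /=; rewrite /e v2rK /F4R_rep mg /=.
  by rewrite !mxE.
have ga : F4R_pred a.
  apply/asboolP; split=> // X Y; apply: val_inj; apply/matrixP => i j.
  by have /= := aC ((X, Y), (i, j)) I; rewrite /e v2rK => ->; rewrite !mxE.
by exists (exist [eta @F4R_pred R] a ga).
Qed.

End F4RLie.

Definition F4R_lie (R : realType) : linearLieGroup R :=
  LinearLieGroup (@F4R_rep_inj R) (F4R_rep1 R) (@F4R_repM R)
    (F4R_rep_closed R).

(* Main.v *)
Require Import Defs.
From mathcomp Require Import all_reals.
From HB Require Import structures.
From mathcomp Require Import all_boot all_order all_fingroup all_algebra.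
From mathcomp Require Import all_classical all_analysis.
From mathcomp Require Import ring.

Set Implicit Arguments.
Unset Strict Implicit.
Unset Printing Implicit Defensive.
Import Order.TTheory GRing.Theory Num.Theory.
Import numFieldNormedType.Exports VectorInternalTheory.
Local Open Scope classical_set_scope.
Local Open Scope ring_scope.

(* The isomorphism sends A in SO(3) to X |-> A X A^T.

   It is onto: the images T_ij of S_ij = E_ij + E_ji under a Jordan automorphism
   obey the same Jordan multiplication table. Starting from a unit vector v_0
   with T_00 v_0 = 2 v_0 and putting v_i = T_i0 v_0 for i != 0, the table forces
   T_kl v_i = v_k [l = i] + v_l [k = i] and makes (v_i) orthonormal, so the matrix
   A of columns v_i intertwines S_ij and T_ij. As 3 is odd, det A * A lies in SO(3).

   Its inverse is polynomial: for A in SO(3) the cofactors of A are its entries,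
   and they are read off the commutators
   [A X A^T, A Y A^T] = A [X, Y] A^T with [E_pp, S_pq] = E_pq - E_qp.
   So in coordinates both directions are restrictions of quadratic maps. *)

(** * Smoothness of linear and quadratic maps in coordinates *)

Section QuadraticMapsAreSmooth.
Variables (R : realType) (m n : nat).
Implicit Types (f : 'rV[R]_m -> 'rV[R]_n).

Lemma linear_rV_rV_continuous f : linear f -> continuous f.
Proof.
move=> lf.
pose f' : {linear 'rV[R]_m -> 'rV[R]_n} :=
  HB.pack f (GRing.isLinear.Build R 'rV[R]_m 'rV[R]_n *:%R f lf).
have -> : f = fun x => \sum_j x ord0 j *: f (delta_mx 0 j).
  apply/funext => x; rewrite {1}(row_sum_delta x) (_ : f = f') //.
  by rewrite linear_sum; apply: eq_bigr => j _; rewrite linearZ.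
apply: continuous_big => [|j _ x]; first exact: add_continuous.
exact: (@cvgZr_tmp _ _ _ (nbhs x) _ _ _ _ (@coord_continuous R _ _ ord0 j x)).
Qed.

Lemma class_Coo_cst (U : set 'rV[R]_m) (c : 'rV[R]_n) : class_Coo U (cst c).
Proof.
move=> k; elim: k c => [|k IH] c; (split; first by move=> x _; exact: cst_continuous) => // v.
split; first by move=> x _; exact: derivable_cst.
by have -> : (fun x => 'D_v (cst c) x) = cst 0 by apply/funext => x; rewrite derive_cst.
Qed.

Lemma is_derive_linear f x v : linear f -> is_derive x v f (f v).
Proof.
move=> lf.
have D : h^-1 *: ((f \o shift x) (h *: v) - f x) @[h --> (0 : R)^'] --> f v.
  apply: cvg_near_cst; near=> h; rewrite /= lf addrK scalerA mulVf ?scale1r //.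
  by near: h; exact: nbhs_dnbhs_neq.
by split; [apply/cvg_ex; exists (f v) | exact: cvg_lim].
Unshelve. all: by end_near. Qed.

Lemma class_Coo_linear (U : set 'rV[R]_m) f : linear f -> class_Coo U f.
Proof.
move=> lf [|k]; (split; first by move=> x _; exact: linear_rV_rV_continuous) => // v.
split=> [x _|]; first by have [] := is_derive_linear x v lf.
have -> : (fun x => 'D_v f x) = cst (f v).
  by apply/funext => x; have [_ ->] := is_derive_linear x v lf.
exact: class_Coo_cst.
Qed.

Variable B : 'rV[R]_m -> 'rV[R]_m -> 'rV[R]_n.
Hypotheses (linBl : forall y, linear (B ^~ y)) (linBr : forall x, linear (B x)).

Lemma quadratic_continuous : continuous (fun x => B x x).
Proof.
pose BL y : {linear 'rV[R]_m -> 'rV[R]_n} :=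
  HB.pack (B ^~ y) (GRing.isLinear.Build R 'rV[R]_m 'rV[R]_n *:%R (B ^~ y) (linBl y)).
have -> : (fun x => B x x) = fun x => \sum_j x ord0 j *: B (delta_mx 0 j) x.
  apply/funext => x; rewrite {1}(row_sum_delta x) -[B _ x]/(BL x _).
  by rewrite linear_sum; apply: eq_bigr => j _; rewrite linearZ.
apply: continuous_big => [|j _ x]; first exact: add_continuous.
exact: (@cvgZ _ _ _ (nbhs x) (nbhs_filter x) _ _ _ _ (@coord_continuous R _ _ ord0 j x)
  (@linear_rV_rV_continuous _ (linBr (delta_mx 0 j)) x)).
Qed.

(** For h != 0 the difference quotient is exactly B x v + B v x + h B v v, and the last term tends
    to 0. [B] may be asymmetric, so the two cross terms stay separate. *)
Lemma is_derive_quadratic x v : is_derive x v (fun x => B x x) (B x v + B v x).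
Proof.
have D : h^-1 *: (((fun x => B x x) \o shift x) (h *: v) - B x x) @[h --> (0 : R)^']
    --> B x v + B v x.
  have -> : B x v + B v x = B x v + B v x + (0 : R) *: B v v by rewrite scale0r addr0.
  apply: (@cvg_trans _ ((B x v + B v x + h *: B v v) @[h --> (0 : R)^'])).
    apply: near_eq_cvg; near=> h.
    have h0 : h != 0 by near: h; exact: nbhs_dnbhs_neq.
    rewrite /= linBl !linBr addrA addrK.
    have E (V : lmodType R) (a b c : V) :
        c + b + h *: a = h^-1 *: (h *: (h *: a + b) + h *: c).
      by rewrite -scalerDr scalerA mulVf // scale1r addrC [c + b]addrC addrA.
    exact: E.
  apply: cvgD; first exact: cvg_cst.
  by apply: cvgZr_tmp; apply: cvg_within.
by split; [apply/cvg_ex; exists (B x v + B v x) | exact: cvg_lim].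
Unshelve. all: by end_near. Qed.

(** Each directional derivative x |-> B x v + B v x is linear in x, so all higher orders fall under
    the linear case, without induction on the order. *)
Lemma class_Coo_quadratic (U : set 'rV[R]_m) : class_Coo U (fun x => B x x).
Proof.
move=> [|k]; (split; first by move=> x _; exact: quadratic_continuous) => // v.
split=> [x _|]; first by have [] := is_derive_quadratic x v.
have -> : (fun x => 'D_v (fun y => B y y) x) = fun x => B x v + B v x.
  by apply/funext => x; have [_ ->] := is_derive_quadratic x v.
apply: class_Coo_linear => a x y.
by rewrite linBl linBr scalerDr addrACA.
Qed.

End QuadraticMapsAreSmooth.

(* On the diagonal this is twice the matrix unit. *)
Definition symm_unit (R : nzRingType) n (i j : 'I_n) : 'M[R]_n :=
  delta_mx i j + delta_mx j i.

Lemma mulmxMnl (R : pzRingType) m n p (A : 'M[R]_(m, n)) (B : 'M[R]_(n, p)) k :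
  (A *+ k) *m B = (A *m B) *+ k.
Proof. exact: (raddfMn (mulmxr B)). Qed.

Lemma mulmxMnr (R : pzRingType) m n p (A : 'M[R]_(m, n)) (B : 'M[R]_(n, p)) k :
  A *m (B *+ k) = (A *m B) *+ k.
Proof. exact: raddfMn. Qed.

(** * Orthonormal frames from the Jordan multiplication table *)

Section JordanFrame.
Variables (R : rcfType) (n : nat) (T : 'I_n.+1 -> 'I_n.+1 -> 'M[R]_n.+1).
Hypothesis T_tr : forall i j, (T i j)^T = T i j.
Hypothesis TC : forall i j, T i j = T j i.
Hypothesis T_jordan : forall i j k l,
  T i j *m T k l + T k l *m T i j =
  T i l *+ (j == k) + T i k *+ (j == l) + T j k *+ (i == l) + T j l *+ (i == k).
Hypothesis T00_neq0 : T 0 0 != 0.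

(** The table used as a commutation rule: [T i j] is moved next to x, where its action is already
    known. *)
Let T_swap i j k l (x : 'cV_n.+1) : T i j *m (T k l *m x) =
  T i l *m x *+ (j == k) + T i k *m x *+ (j == l) + T j k *m x *+ (i == l)
  + T j l *m x *+ (i == k) - T k l *m (T i j *m x).
Proof.
rewrite !mulmxA -[in LHS](addrK (T k l *m T i j) (T i j *m T k l)) T_jordan.
by rewrite mulmxBl !mulmxDl !mulmxMnl.
Qed.

Let two_neq0 : 2%:R != 0 :> R. Proof. by rewrite pnatr_eq0. Qed.

(** With all four indices equal the table reads 2 T_ii^2 = 4 T_ii. *)
Let T_idem i : T i i *m T i i = 2%:R *: T i i.
Proof.
have := T_jordan i i i i; rewrite eqxx !mulr1n => E.
apply: (scalerI two_neq0).
by rewrite !scaler_nat mulr2n E !mulr2n addrA.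
Qed.

(* By T_idem the only possible eigenvalues of T_ii are 0 and 2. *)
Let T_eigenN2 i (x : 'cV_n.+1) : T i i *m x = - (2%:R *: x) -> x = 0.
Proof.
move=> Tx; have := T_idem i => /(congr1 (mulmx^~ x)).
rewrite -mulmxA -scalemxAl Tx mulmxN -scalemxAr Tx => E.
have : 8%:R *: x = 0.
  apply/eqP; rewrite -[8%N]/(4 + 4)%N natrD scalerDl addr_eq0; apply/eqP.
  by move: E; rewrite !scalerN opprK !scalerA -natrM.
by move/eqP; rewrite scaler_eq0 pnatr_eq0 /= => /eqP.
Qed.

(** By [T_idem] every column of T_00 is fixed up to the factor 2; a nonzero column, divided by its
    Euclidean norm, is the required vector. *)
Let exists_unit_eigenvector : exists2 v : 'cV_n.+1,
  T 0 0 *m v = 2%:R *: v & v^T *m v = 1%:M.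
Proof.
have [j uj] : exists j, col j (T 0 0) != 0.
  apply/existsP; apply: contraNT T00_neq0; rewrite negb_exists => /forallP u0.
  apply/eqP/matrixP => i j; have := u0 j; rewrite negbK => /eqP/matrixP/(_ i 0).
  by rewrite !mxE.
set u := col j _ in uj.
have Tu : T 0 0 *m u = 2%:R *: u by rewrite /u colE mulmxA T_idem scalemxAl.
pose q := \sum_i u i 0 ^+ 2.
have q0 : 0 < q.
  rewrite lt_def sumr_ge0 ?andbT => [|i _]; last exact: sqr_ge0.
  apply: contraNneq uj => /eqP; rewrite psumr_eq0 => [/allP u0|i _]; last exact: sqr_ge0.
  apply/eqP/colP => i; have := u0 i (mem_index_enum _).
  by rewrite /= sqrf_eq0 [RHS]mxE => /eqP.
have uu : u^T *m u = q%:M.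
  apply/matrixP => a b; rewrite !ord1 [RHS]mxE [LHS]mxE eqxx mulr1n.
  by apply: eq_bigr => i _; rewrite mxE expr2.
exists ((Num.sqrt q)^-1 *: u).
  by rewrite -scalemxAr Tu !scalerA mulrC.
rewrite -scalemxAr linearZ /= -scalemxAl uu scalerA scale_scalar_mx.
by rewrite -invfM -expr2 sqr_sqrtr ?ltW // mulVf ?gt_eqF.
Qed.

Lemma jordan_frame_orthogonal : exists2 A : 'M[R]_n.+1,
  A^T *m A = 1%:M & forall i j, T i j *m A = A *m symm_unit R i j.
Proof.
have [v0 Tv0 v0v0] := exists_unit_eigenvector.
pose v i := if i == 0 then v0 else T i 0 *m v0.
have vE i : i != 0 -> v i = T i 0 *m v0 by rewrite /v => /negPf ->.
have v00 : v 0 = v0 by rewrite /v eqxx.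
have Tkl0 k l : k != 0 -> l != 0 -> T k l *m v0 = 0.
  (* T_kl shares no index with T_00, so the two anticommute and T_kl v_0 satisfies the eigenvector
     equation for -2; hence it vanishes. T_k0 v_i with k != i is treated below in the same way,
     using T_ii. *)
  move=> /negPf k0 /negPf l0; apply: (@T_eigenN2 0).
  by rewrite T_swap ![0 == _]eq_sym k0 l0 !mulr0n !addr0 add0r Tv0 -scalemxAr.
have T00 i : i != 0 -> T 0 0 *m v i = 0.
  move=> i0; rewrite vE // T_swap ![0 == _]eq_sym (negPf i0) eqxx !mulr0n.
  by rewrite !mulr1n Tv0 -scalemxAr -[T 0 i]TC scaler_nat mulr2n !addr0 add0r subrr.
have Tkli k l i : k != 0 -> l != 0 -> i != 0 ->
    T k l *m v i = v k *+ (l == i) + v l *+ (k == i).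
  move=> k0 l0 i0; rewrite [in LHS]vE // T_swap (negPf k0) (negPf l0) !mulr0n !addr0.
  by rewrite (Tkl0 k l) // mulmx0 subr0 -!vE.
have Tk0i k i : k != 0 -> i != 0 -> T k 0 *m v i = v0 *+ (k == i).
  move=> k0 i0; have [<-{i i0}|ki] := eqVneq k i.
    have E (x y : 'cV[R]_n.+1) : x = 2%:R *: y - x -> x = y.
      move=> /eqP; rewrite -subr_eq opprK -mulr2n -scaler_nat => /eqP.
      exact: (scalerI two_neq0).
    (* Here T_k0 is swapped with itself: x = T_k0 T_k0 v_0 satisfies x = T_kk v_0 + T_00 v_0 - x,
       where T_kk v_0 = 0 and T_00 v_0 = 2 v_0. *)
    apply: E; rewrite [in LHS]vE // T_swap -vE // !eqxx ![0 == _]eq_sym (negPf k0).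
    by rewrite !mulr0n !mulr1n (Tkl0 k k) // Tv0 !add0r.
  apply: (@T_eigenN2 i).
  rewrite T_swap ![i == _]eq_sym (negPf ki) ![0 == _]eq_sym (negPf i0) !mulr0n !add0r.
  by rewrite Tkli // eqxx -mulr2n -scaler_nat -scalemxAr.
have Tv k l i : T k l *m v i = v k *+ (l == i) + v l *+ (k == i).
  have [->{k}|k0] := eqVneq k 0; have [->{l}|l0] := eqVneq l 0;
    have [->{i}|i0] := eqVneq i 0.
  - by rewrite v00 Tv0 scaler_nat.
  - by rewrite T00 // !mulr0n addr0.
  - by rewrite TC v00 -vE // (negPf l0) mulr0n add0r.
  - by rewrite TC Tk0i // v00 mulr0n addr0.
  - by rewrite v00 -vE // (negPf k0) mulr0n addr0.
  - by rewrite Tk0i // v00 mulr0n add0r.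
  - by rewrite v00 Tkl0 // (negPf l0) (negPf k0) !mulr0n addr0.
  - exact: Tkli.
have vTv i j k l : (T i j *m v k)^T *m v l = (v k)^T *m (T i j *m v l).
  by rewrite trmx_mul T_tr mulmxA.
(* The symmetric T_ii has eigenvalue 2 on v_i and 0 on v_j, which makes them orthogonal. For the
   norm, one factor T_i0 of v_i = T_i0 v_0 is moved across the product, and T_i0 v_i = v_0. *)
have vv i j : (v i)^T *m v j = (i == j)%:R%:M.
  have [<-{j}|ij] := eqVneq i j.
    have [->|i0] := eqVneq i 0; first by rewrite v00.
    by rewrite {1}(vE _ i0) -v00 vTv Tk0i // eqxx -v00 v00.
  have := vTv i i i j; rewrite !Tv eqxx (negPf ij) !mulr0n addr0 mulmx0 -mulr2n.
  rewrite -scaler_nat linearZ -scalemxAl => /eqP.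
  rewrite scaler_eq0 pnatr_eq0 /= => /eqP ->.
  by rewrite raddf0.
pose A := \matrix_(r, i) v i r 0.
have Acol i : A *m delta_mx i 0 = v i by rewrite -colE; apply/colP => r; rewrite !mxE.
exists A.
  apply/matrixP => i j; have /matrixP/(_ 0 0) := vv i j; rewrite !mxE eqxx mulr1n => <-.
  by apply: eq_bigr => r _; rewrite !mxE.
move=> k l; apply/matrixP => r i.
suff /colP/(_ r) : T k l *m A *m delta_mx i (0 : 'I_1) =
    A *m symm_unit R k l *m delta_mx i 0.
  by rewrite -!colE [LHS]mxE [RHS]mxE.
rewrite -!mulmxA Acol Tv mulmxDl !mul_delta_mx_cond mulmxDr.
by rewrite !mulmxMnr !Acol.
Qed.
End JordanFrame.

(** * Cofactors in dimension 3 and the table of the symmetric units *)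

Lemma det_mx22 (R : comNzRingType) (M : 'M[R]_2) :
  \det M = M 0 0 * M 1 1 - M 0 1 * M 1 0.
Proof.
rewrite (expand_det_row _ 0) !big_ord_recl big_ord0 /cofactor !det_mx11 !mxE /=.
rewrite expr0 addr0 expr1 mul1r mulN1r mulrN.
by congr (M _ _ * M _ _ - M _ _ * M _ _); apply/val_inj.
Qed.

(* Cyclic indexing in Z/3 absorbs the checkerboard signs. *)
Lemma cofactor3 (R : comNzRingType) (A : 'M[R]_3) i k :
  cofactor A i k = A (i + 1) (k + 1) * A (i + 2%:R) (k + 2%:R)
                 - A (i + 1) (k + 2%:R) * A (i + 2%:R) (k + 1).
Proof.
rewrite /cofactor det_mx22 !mxE.
(* Reading entries through natural numbers identifies ordinals that differ only in their bound
   proofs, so that [ring] sees equal atoms. *)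
pose a m n := A (inord m) (inord n).
have aE i' j' : A i' j' = a i' j' by rewrite /a !inord_val.
rewrite !aE; case: i k => [[|[|[|//]]] i3] [[|[|[|//]]] k3];
  rewrite /= /bump /= ?modnE /=; ring.
Qed.

(** Since det A = 1, the adjugate is the inverse, which is A^T by orthogonality. *)
Lemma SO3_cofactor (R : realType) (A : SO3 R) i k :
  cofactor (val A) i k = val A i k.
Proof.
have /andP[/eqP AA /eqP dA] := valP A.
have -> : cofactor (val A) i k = (\adj (val A))^T i k by rewrite !mxE.
have -> : \adj (val A) = (val A)^T; last by rewrite trmxK.
by rewrite -[LHS]mul1mx -(mulmx1C AA) -mulmxA mul_mx_adj dA mulmx1.
Qed.

Lemma symm_unit_jordan (R : comNzRingType) n (i j k l : 'I_n) :
  symm_unit R i j *m symm_unit R k l + symm_unit R k l *m symm_unit R i j =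
  symm_unit R i l *+ (j == k) + symm_unit R i k *+ (j == l)
  + symm_unit R j k *+ (i == l) + symm_unit R j l *+ (i == k).
Proof.
rewrite /symm_unit !(mulmxDl, mulmxDr) !mul_delta_mx_cond !mulrnDl.
rewrite ![l == _]eq_sym ![k == _]eq_sym.
by apply/matrixP => a b; rewrite !(mxE, mulmxnE); ring.
Qed.

Lemma mulmx_conj (R : comNzRingType) n (A M N : 'M[R]_n) : A^T *m A = 1%:M ->
  A *m M *m A^T *m (A *m N *m A^T) = A *m (M *m N) *m A^T.
Proof. by move=> AtA; rewrite !mulmxA -(mulmxA (A *m M)) AtA mulmx1. Qed.

(** * Every Jordan automorphism is a conjugation *)

Section JordanAutomorphisms.
Variable R : realType.
Implicit Types (A B : 'M[R]_3) (a b : 'End(jordan3 R)).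

Lemma symm_unit_subproof (i j : 'I_3) : symm_unit R i j \in symmx3 R.
Proof. by rewrite mem_symmx3 linearD /= !trmx_delta addrC. Qed.

Definition jordan_unit i j : jordan3 R := Subvs (symm_unit_subproof i j).

(** The sum runs over ordered pairs: off the diagonal each S_ij occurs twice, and on it S_ii = 2
    E_ii, whence the coefficient 1/2. *)
Lemma jordan_unit_sum (X : jordan3 R) :
  X = \sum_i \sum_j (2^-1 * vsval X i j) *: jordan_unit i j.
Proof.
have /eqP XT : (vsval X)^T == vsval X by rewrite -mem_symmx3 subvsP.
apply/val_inj; rewrite linear_sum /=.
under eq_bigr do rewrite linear_sum /=.
under eq_bigr do under eq_bigr do rewrite /= scalerDr.
under eq_bigr do rewrite big_split /=.
rewrite big_split /=.
have E : vsval X = 2^-1 *: vsval X + 2^-1 *: (vsval X)^T.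
  by rewrite XT -scalerDl (_ : 2^-1 + 2^-1 = 1) ?scale1r //; field.
rewrite [LHS]E [in LHS](matrix_sum_delta (vsval X)) !linear_sum /=.
congr (_ + _); apply: eq_bigr => i _; rewrite !linear_sum /=; apply: eq_bigr => j _.
  by rewrite scalerA.
by rewrite linearZ /= trmx_delta scalerA.
Qed.

(** Two matrices are allowed so that the map is bilinear in (A, B), as the smoothness proof
    requires. A X B^T need not be symmetric, hence the projection, which acts trivially when A =
    B. *)
Definition conj_lfun A B : 'End(jordan3 R) :=
  linfun (fun X : jordan3 R => vsproj (symmx3 R) (A *m vsval X *m B^T)).

Lemma conj_lfun_linear A B :
  linear (fun X : jordan3 R => vsproj (symmx3 R) (A *m vsval X *m B^T)).
Proof.
move=> c X Y /=.
by rewrite !linearP /= mulmxDl -scalemxAl linearP.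
Qed.

Lemma conj_lfun_apply A B X :
  conj_lfun A B X = vsproj (symmx3 R) (A *m vsval X *m B^T).
Proof.
pose f : {linear jordan3 R -> jordan3 R} := HB.pack
  (fun X : jordan3 R => vsproj (symmx3 R) (A *m vsval X *m B^T))
  (GRing.isLinear.Build R (jordan3 R) (jordan3 R) *:%R _ (conj_lfun_linear A B)).
by rewrite /conj_lfun (lfunE f).
Qed.

Lemma conj_lfunE A X : vsval (conj_lfun A A X) = A *m vsval X *m A^T.
Proof.
rewrite conj_lfun_apply vsprojK // mem_symmx3 !trmx_mul trmxK mulmxA.
by have := subvsP X; rewrite mem_symmx3 => /eqP ->.
Qed.

Lemma F4R_exists_conj (a : F4R R) :
  exists A : SO3 R, val a = conj_lfun (val A) (val A).
Proof.
have /asboolP[ba ma] := valP a.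
have [||||A AA aA] :=
  @jordan_frame_orthogonal R 2 (fun i j => vsval (val a (jordan_unit i j))).
- move=> i j; apply/eqP; rewrite -mem_symmx3; exact: subvsP.
- move=> i j; congr (vsval (val a _)); apply/val_inj => /=; exact: addrC.
- move=> i j k l.
  have J X Y : vsval (val a X) *m vsval (val a Y) + vsval (val a Y) *m vsval (val a X)
      = 2%:R *: vsval (val a (jordan_mul X Y)).
    by rewrite ma /= scalerA mulfV ?pnatr_eq0 // scale1r.
  rewrite J -!raddfMn -!raddfD -!linearZ; congr (vsval (val a _)).
  apply/val_inj; rewrite linearZ /= scalerA mulfV ?pnatr_eq0 // scale1r.
  by rewrite symm_unit_jordan !raddfMn.
- have /bij_inj ia := ba.
  apply: contraTneq (oner_neq0 R) => a0.
  have : jordan_unit 0 0 = 0 by apply: ia; apply/val_inj; rewrite linear0.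
  move=> /(congr1 val)/matrixP/(_ 0 0); rewrite !mxE /= => /eqP.
  by rewrite -mulr2n pnatr_eq0.
have aX X : vsval (val a X) *m A = A *m vsval X.
  rewrite (jordan_unit_sum X) !linear_sum /= mulmx_suml.
  apply: eq_bigr => i _; rewrite !linear_sum /= mulmx_suml.
  by apply: eq_bigr => j _; rewrite !linearZ /= -scalemxAl aA.
have d2 : \det A * \det A = 1 by rewrite -{1}[\det A]det_tr -det_mulmx AA det1.
(* The frame is only orthogonal, with determinant 1 or -1. Multiplying A by this sign makes the
   determinant 1 and leaves X |-> A X A^T unchanged. *)
have SA : SO3_pred (\det A *: A).
  rewrite /SO3_pred linearZ -scalemxAl -scalemxAr scalerA d2 scale1r (mulmx1C AA).
  by rewrite detZ !exprS expr0 mulr1 -mulrA -mulrA d2 mulr1 d2 !eqxx.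
exists (exist [eta @SO3_pred R] _ SA); apply/lfunP => X; apply/val_inj.
rewrite /= conj_lfunE linearZ -!scalemxAl -scalemxAr scalerA d2 scale1r.
by rewrite -aX -mulmxA (mulmx1C AA) mulmx1.
Qed.
End JordanAutomorphisms.

(** * Conjugation by SO(3) and its polynomial inverse *)

Section Isomorphism.
Variable R : realType.
Implicit Types (A : SO3 R).

Lemma F4R_conj_subproof A : F4R_pred (conj_lfun (val A) (val A)).
Proof.
have /andP[/eqP AA _] := valP A; have AtA := mulmx1C AA.
apply/asboolP; split=> [|X Y].
  exists (conj_lfun (val A)^T (val A)^T) => X; apply/val_inj; rewrite /= !conj_lfunE trmxK.
    by rewrite !mulmxA AtA mul1mx -mulmxA AtA mulmx1.
  by rewrite !mulmxA AA mul1mx -mulmxA AA mulmx1.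
apply/val_inj; rewrite /= !conj_lfunE /= -scalemxAr -scalemxAl; congr (_ *: _).
by rewrite !mulmx_conj // mulmxDr mulmxDl.
Qed.

Definition F4R_conj A : F4R R := exist [eta @F4R_pred R] _ (F4R_conj_subproof A).

Lemma F4R_conjM : {morph F4R_conj : A B / (A * B)%g}.
Proof.
move=> A B; apply/val_inj/lfunP => X; apply/val_inj.
by rewrite /= comp_lfunE !conj_lfunE trmx_mul !mulmxA.
Qed.

(* At a = b this is the (i+1, i+2) entry of the commutator of the images of E_pp
   and S_pq, where p = k+1, q = k+2 and indices are taken in Z/3. It is polarized
   in order to exhibit a quadratic map. *)
Definition axis_mx (a b : 'End(jordan3 R)) : 'M[R]_3 := \matrix_(i, k)
  (2^-1 * (vsval (a (jordan_unit R (k + 1) (k + 1))) *m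
           vsval (b (jordan_unit R (k + 1) (k + 2%:R)))
         - vsval (a (jordan_unit R (k + 1) (k + 2%:R))) *m
           vsval (b (jordan_unit R (k + 1) (k + 1)))) (i + 1) (i + 2%:R)).

(** The commutator is 2 A (E_pq - E_qp) A^T, because S_pp = 2 E_pp; the factor 1/2 cancels the 2.
    Its (i+1, i+2) entry is a 2 x 2 minor, namely the (i, k) cofactor of A, which equals A_ik. *)
Lemma axis_mx_conj A :
  axis_mx (conj_lfun (val A) (val A)) (conj_lfun (val A) (val A)) = val A.
Proof.
have /andP[/eqP AA _] := valP A; have AtA := mulmx1C AA.
have D (r s p q : 'I_3) : (val A *m delta_mx p q *m (val A)^T) r s = val A r p * val A s q.
  by rewrite -(mul_delta_mx (0 : 'I_1)) mulmxA -colE -mulmxA -rowE mxE big_ord1 !mxE.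
apply/matrixP => i k; rewrite mxE !conj_lfunE !mulmx_conj // -mulmxBl -mulmxBr /=.
have pq : (k + 1 == k + 2%:R) = false by case: k => [[|[|[|//]]] ?].
set p := k + 1 in pq *; set q := k + 2%:R in pq *.
have -> : symm_unit R p p *m symm_unit R p q - symm_unit R p q *m symm_unit R p p
    = 2%:R *: (delta_mx p q - delta_mx q p).
  rewrite /symm_unit !(mulmxDl, mulmxDr) !mul_delta_mx_cond !eqxx ![q == p]eq_sym pq.
  rewrite !(mulr0n, mulr1n); apply/matrixP => x y; rewrite !mxE; ring.
rewrite -scalemxAr -scalemxAl [X in _ * X]mxE mulKf ?pnatr_eq0 //.
rewrite mulmxBr mulmxBl mxE D [X in _ + X]mxE D -(SO3_cofactor A i k) cofactor3.
by congr (_ - _); rewrite mulrC.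
Qed.

Lemma F4R_axis_subproof (a : F4R R) : SO3_pred (axis_mx (val a) (val a)).
Proof. by have [A ->] := F4R_exists_conj a; rewrite axis_mx_conj; exact: valP. Qed.

Definition F4R_axis (a : F4R R) : SO3 R :=
  exist [eta @SO3_pred R] _ (F4R_axis_subproof a).

Lemma F4R_conjK : cancel F4R_conj F4R_axis.
Proof. by move=> A; apply/val_inj; exact: axis_mx_conj. Qed.

Lemma F4R_axisK : cancel F4R_axis F4R_conj.
Proof.
move=> a; have [A aA] := F4R_exists_conj a.
have -> : a = F4R_conj A by exact: val_inj.
by rewrite F4R_conjK.
Qed.

Lemma F4R_axisM : {morph F4R_axis : a b / (a * b)%g}.
Proof.
move=> a b; apply: (can_inj F4R_conjK).
by rewrite F4R_conjM !F4R_axisK.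
Qed.

(** The formula a |-> B a a makes sense on all endomorphisms, so a single global extension serves
    near every point. *)
Lemma lie_smooth_quadratic (G H : linearLieGroup R) (f : G -> H)
    (B : 'End(lie_space G) -> 'End(lie_space G) -> 'End(lie_space H)) :
  (forall b, linear (B ^~ b)) -> (forall a, linear (B a)) ->
  (forall g, lie_rep (f g) = B (lie_rep g) (lie_rep g)) -> lie_smooth f.
Proof.
move=> lBl lBr fB g.
exists setT, (fun x => v2r (B (r2v x) (r2v x))); split=> //.
- exact: openT.
- apply: (class_Coo_quadratic (B := fun x y => v2r (B (r2v x) (r2v y)))) => x c y z.
  + by rewrite linearP lBl linearP.
  + by rewrite linearP lBr linearP.
- by move=> h _; rewrite /lie_coord v2rK fB.
Qed.

End Isomorphism.

(** * Smoothness in both directions *)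

(** A linear left inverse of [SO3_rep], defined on all endomorphisms and not just on the image of
    the group. *)
Definition mx_of_lfun (R : realType) (a : 'End('cV[R]_3)) : 'M[R]_3 :=
  \matrix_(i, j) a (delta_mx j 0) i 0.

Lemma mx_of_SO3_rep (R : realType) (A : SO3 R) : mx_of_lfun (SO3_rep A) = val A.
Proof. by apply/matrixP => i j; rewrite !mxE SO3_repE -colE mxE. Qed.

Lemma mx_of_lfun_linear (R : realType) : linear (@mx_of_lfun R).
Proof. by move=> c a b; apply/matrixP => i j; rewrite !mxE add_lfunE scale_lfunE !mxE. Qed.

Lemma F4R_conj_smooth (R : realType) :
  @lie_smooth R (SO3_lie R) (F4R_lie R) (@F4R_conj R).
Proof.
apply: (@lie_smooth_quadratic R (SO3_lie R) (F4R_lie R) _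
  (fun a b => conj_lfun (mx_of_lfun a) (mx_of_lfun b))) => [b|a|A] /=.
- move=> c a a'; apply/lfunP => X; rewrite mx_of_lfun_linear add_lfunE scale_lfunE.
  rewrite !conj_lfun_apply -linearP; congr (vsproj _ _).
  by rewrite !mulmxDl -!scalemxAl.
- move=> c b b'; apply/lfunP => X; rewrite mx_of_lfun_linear add_lfunE scale_lfunE.
  rewrite !conj_lfun_apply -linearP; congr (vsproj _ _).
  by rewrite linearP mulmxDr -scalemxAr.
by rewrite mx_of_SO3_rep.
Qed.

Lemma F4R_axis_smooth (R : realType) :
  @lie_smooth R (F4R_lie R) (SO3_lie R) (@F4R_axis R).
Proof.
have mulL (M N : 'M[R]_3) c : linfun (mulmx (c *: M + N)) =
    c *: linfun (mulmx M) + linfun (mulmx N) :> 'End('cV[R]_3).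
  apply/lfunP => x; rewrite add_lfunE scale_lfunE !lfunE /=.
  by rewrite mulmxDl scalemxAl.
(* Unlike [mxE], these rules leave matrix products folded, so [ring] treats their entries as
   atoms. *)
have eD (M N : 'M[R]_3) r s : (M + N) r s = M r s + N r s by rewrite mxE.
have eN (M : 'M[R]_3) r s : (- M) r s = - M r s by rewrite mxE.
have eZ (M : 'M[R]_3) c r s : (c *: M) r s = c * M r s by rewrite mxE.
apply: (@lie_smooth_quadratic R (F4R_lie R) (SO3_lie R) _
  (fun a b => linfun (mulmx (axis_mx a b)) : 'End('cV[R]_3))) => [b|a|A] //=.
- move=> c a a'; rewrite -mulL; congr (linfun (mulmx _)); apply/matrixP => i k.
  rewrite [LHS]mxE !add_lfunE !scale_lfunE !linearP /= !mulmxDl -!scalemxAl.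
  rewrite [RHS]mxE [X in _ = X + _]mxE [axis_mx a b i k]mxE [axis_mx a' b i k]mxE.
  by rewrite !(eD, eN, eZ); ring.
- move=> c b b'; rewrite -mulL; congr (linfun (mulmx _)); apply/matrixP => i k.
  rewrite [LHS]mxE !add_lfunE !scale_lfunE !linearP /=.
  rewrite [RHS]mxE [X in _ = X + _]mxE [axis_mx a b i k]mxE [axis_mx a b' i k]mxE.
  by rewrite !(eD, eN, eZ); ring.
Qed.

Theorem theorem3p4 (R : realType) : lie_isomorphic (F4R_lie R) (SO3_lie R).
Proof.
pose f : {multiplicative F4R R -> SO3 R} :=
  HB.pack (@F4R_axis R) (isMultiplicative.Build _ _ _ (@F4R_axisM R)).
exists f, (@F4R_conj R); split.
- exact: F4R_axisK.
- exact: F4R_conjK.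
- exact: F4R_axis_smooth.
- exact: F4R_conj_smooth.
Qed.
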